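(* Let $\{\lambda_k\}_{k\in\mathbb N}$ be a sequence of positive numbers that is rationally commensurable, i.e. there is a finite collection of numbers $\lambda_{j_1},\dots,\lambda_{j_m}$ (with distinct indices) such that one of them is a linear combination, with rational coefficients, of the others. Let the sequence $\{1/\lambda_k\}$ be unbounded. Then for any non-degenerate torus $\mathbb T$, every trajectory on $\mathbb T$ of the Hamiltonian system with Hamilton function $H(q,p)=\sum_{k=1}^{\infty}\frac{\lambda_k}{2}(p_k^2+q_k^2)$ is neither periodic nor dense in $\mathbb T$.
   Context: The phase space is the real Hilbert space $E=Q\oplus P$ with $Q=P=\ell_2(\mathbb N,\mathbb R)$, identified with the complex space $\ell_2=\ell_2(\mathbb N,\mathbb C)$ by $z_k=q_k+ip_k$. The flow of the Hamiltonian system with frequencies $\{\lambda_k\}$ is the group $\mathbf V_t$, $t\in\mathbb R$, given by $(\mathbf V_t z_0)_k=e^{i\lambda_k t}z_{0,k}$, $k\in\mathbb N$. The trajectory through $z_0$ is $z(t)=\mathbf V_t z_0$, $t\in\mathbb R$; it is periodic if there is $\tau>0$ with $z(t+\tau)=z(t)$ for all $t\in\mathbb R$. A non-degenerate torus is a set $\mathbb T=\{z\in\ell_2:\ |z_k|=r_k,\ k\in\mathbb N\}$ where $\{r_k\}\in\ell_2$ is a sequence of positive numbers; it carries the topology induced by the norm of $E$. *)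

(* Defs.v *)
From HB Require Import structures.
From mathcomp Require Import all_boot all_order all_algebra.
From mathcomp Require Import ring complex.
From mathcomp Require Import all_classical all_reals all_analysis.

Set Implicit Arguments.
Unset Strict Implicit.
Unset Printing Implicit Defensive.

Import Order.TTheory GRing.Theory Num.Theory.
Import numFieldNormedType.Exports.

Local Open Scope classical_set_scope.
Local Open Scope ring_scope.

Section SquareSummable.
Context {R : realType} {V : normedZmodType R}.
Implicit Types x y z : nat -> V.

Definition square_summable z : Prop :=
  cvgn (series (fun k => `|z k| ^+ 2)).

Definition ell2_norm z : R :=
  Num.sqrt (limn (series (fun k => `|z k| ^+ 2))).

Lemma le_square_summable (v : nat -> R) z :
  (forall k, `|z k| ^+ 2 <= v k) -> cvgn (series v) -> square_summable z.
Proof.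
move=> zv; apply: series_le_cvg => // k.
by apply: le_trans (zv k); exact: sqr_ge0.
Qed.

Lemma le_lim_series_sqr z (n : nat) : square_summable z ->
  series (fun k => `|z k| ^+ 2) n <= limn (series (fun k => `|z k| ^+ 2)).
Proof.
move=> sz; apply: (nondecreasing_cvgn_le _ sz n).
by apply/nondecreasing_series => k _ _; exact: sqr_ge0.
Qed.

Lemma sqr_ell2_norm z : square_summable z ->
  ell2_norm z ^+ 2 = limn (series (fun k => `|z k| ^+ 2)).
Proof.
move=> sz; rewrite sqr_sqrtr//.
by have := le_lim_series_sqr 0 sz; rewrite seriesEnat/= big_geq.
Qed.

Lemma ell2_norm_ge0 z : 0 <= ell2_norm z.
Proof. exact: sqrtr_ge0. Qed.

Lemma ell2_norm_eq0 z : square_summable z ->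
  ell2_norm z = 0 -> forall k, z k = 0.
Proof.
move=> sz z0 k; apply/eqP; rewrite -normr_eq0 -sqrf_eq0 eq_le.
apply/andP; split; last exact: sqr_ge0.
have := le_lim_series_sqr k.+1 sz; rewrite -sqr_ell2_norm// z0 expr0n/=.
apply: le_trans; rewrite seriesSr lerDr seriesEnat/=.
by apply: sumr_ge0 => i _; exact: sqr_ge0.
Qed.

Lemma sqr_normD_le (c : R) (a b : V) : 0 < c ->
  `|a + b| ^+ 2 <= (1 + c) * `|a| ^+ 2 + (1 + c^-1) * `|b| ^+ 2.
Proof.
move=> c0; apply: (@le_trans _ _ ((`|a| + `|b|) ^+ 2)).
  by rewrite lerXn2r// ?nnegrE ?addr_ge0// ler_normD.
rewrite -subr_ge0.
have -> : (1 + c) * `|a| ^+ 2 + (1 + c^-1) * `|b| ^+ 2 - (`|a| + `|b|) ^+ 2 =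
    c^-1 * (c * `|a| - `|b|) ^+ 2.
  by field; exact: lt0r_neq0.
by apply: mulr_ge0; [rewrite invr_ge0 ltW | exact: sqr_ge0].
Qed.

Lemma square_summable0 : square_summable (fun=> 0 : V).
Proof.
apply: (@le_square_summable (0 : R ^nat)) => [k|].
  by rewrite normr0 expr0n.
rewrite (_ : series _ = fun=> 0); first exact: is_cvg_cst.
by apply/funext => n; rewrite seriesEnat/= big1.
Qed.

Section Add.
Variables (x y : nat -> V) (c : R).
Hypotheses (sx : square_summable x) (sy : square_summable y) (c0 : 0 < c).

Let w := (1 + c) *: (fun k => `|x k| ^+ 2 : R) +
         (1 + c^-1) *: (fun k => `|y k| ^+ 2 : R) : R ^nat.

Let sw : cvgn (series w).
Proof. by apply: is_cvg_seriesD; exact: is_cvg_seriesZ. Qed.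

Let sD : square_summable (fun k => x k + y k).
Proof. by apply: le_square_summable sw => k; exact: sqr_normD_le. Qed.

Lemma ell2_normD_sqr : ell2_norm (fun k => x k + y k) ^+ 2 <=
  (1 + c) * ell2_norm x ^+ 2 + (1 + c^-1) * ell2_norm y ^+ 2.
Proof.
rewrite !sqr_ell2_norm//.
rewrite -[X in _ <= X](_ : limn (series w) = _).
  by apply: lim_series_le => // k; exact: sqr_normD_le.
rewrite lim_seriesD; [by rewrite !lim_seriesZ| |]; exact: is_cvg_seriesZ.
Qed.

Lemma square_summableD_gt0 : square_summable (fun k => x k + y k).
Proof. exact: sD. Qed.

End Add.

Lemma square_summableD x y : square_summable x -> square_summable y ->
  square_summable (fun k => x k + y k).
Proof. by move=> sx sy; exact: (square_summableD_gt0 sx sy ltr01). Qed.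

Lemma ell2_normD x y : square_summable x -> square_summable y ->
  ell2_norm (fun k => x k + y k) <= ell2_norm x + ell2_norm y.
Proof.
move=> sx sy.
have [x0|xn0] := eqVneq (ell2_norm x) 0.
  rewrite x0 add0r le_eqVlt; apply/orP; left; apply/eqP; congr ell2_norm.
  by apply/funext => k; rewrite (ell2_norm_eq0 sx x0) add0r.
have [y0|yn0] := eqVneq (ell2_norm y) 0.
  rewrite y0 addr0 le_eqVlt; apply/orP; left; apply/eqP; congr ell2_norm.
  by apply/funext => k; rewrite (ell2_norm_eq0 sy y0) addr0.
have X0 : 0 < ell2_norm x by rewrite lt0r xn0 ell2_norm_ge0.
have Y0 : 0 < ell2_norm y by rewrite lt0r yn0 ell2_norm_ge0.
rewrite -(@ler_pXn2r _ 2)// ?nnegrE ?addr_ge0 ?ell2_norm_ge0//.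
apply: (le_trans (ell2_normD_sqr sx sy (divr_gt0 Y0 X0))).
rewrite le_eqVlt; apply/orP; left; apply/eqP.
by field; rewrite xn0 yn0.
Qed.

End SquareSummable.

(* [Rcomplex R] is R[i] seen as a real vector space; its norm is the modulus,
   with values in R. Hence [ell2 R] is the real normed space underlying
   l_2(N, C), with q_k = Re (z k), p_k = Im (z k) and
   ||z||^2 = \sum_k (q_k^2 + p_k^2). Indices start at 0. *)
Definition ell2_pred {R : realType} : {pred nat -> Rcomplex R} :=
  fun z => `[< square_summable z >].

Record ell2 (R : realType) := Ell2 {
  ell2_val :> nat -> Rcomplex R ;
  ell2_valP : ell2_val \in ell2_pred }.

HB.instance Definition _ (R : realType) := [isSub for @ell2_val R].
HB.instance Definition _ (R : realType) := [Choice of ell2 R by <:].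

Section Ell2.
Context {R : realType}.
Implicit Types x y z : ell2 R.

Lemma ell2P z : square_summable z.
Proof. by case: z => z /= /asboolP. Qed.
#[local] Arguments ell2P z : clear implicits.

Lemma norm_scale_Rcomplex (a : R) (u : Rcomplex R) : `|a *: u| = `|a| * `|u|.
Proof.
have -> : a *: u = (a%:C%C : Rcomplex R) * u.
  by case: u => p q /=; congr (_ +i* _)%C; ring.
rewrite [LHS]Normc.normcM; congr (_ * _).
by rewrite /= expr0n/= addr0 sqrtr_sqr.
Qed.

Fact ell2_submod_closed : submod_closed (@ell2_pred R).
Proof.
split=> [|a x y /asboolP sx /asboolP sy]; apply/asboolP.
  exact: square_summable0.
apply: square_summableD => //.
apply: le_square_summable (is_cvg_seriesZ (k := a ^+ 2) sx) => k.
by rewrite norm_scale_Rcomplex exprMn real_normK ?num_real.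
Qed.

HB.instance Definition _ := GRing.isSubmodClosed.Build R (nat -> Rcomplex R)
  ell2_pred ell2_submod_closed.
HB.instance Definition _ := [SubChoice_isSubLmodule of ell2 R by <:].

Lemma ell2_valD x y : ell2_val (x + y) = fun k => x k + y k.
Proof. by rewrite -[LHS]/(val (x + y)) raddfD. Qed.

Lemma ell2_valZ (a : R) x : ell2_val (a *: x) = fun k => a *: x k.
Proof. by rewrite -[LHS]/(val (a *: x)) linearZ. Qed.

Fact ell2_ler_normD x y :
  ell2_norm (x + y : ell2 R) <= ell2_norm x + ell2_norm y.
Proof. by rewrite ell2_valD; exact: ell2_normD (ell2P x) (ell2P y). Qed.

Fact ell2_normrZ (a : R) x : ell2_norm (a *: x : ell2 R) = `|a| * ell2_norm x.
Proof.
rewrite ell2_valZ /ell2_norm -sqrtr_sqr -sqrtrM ?sqr_ge0//; congr Num.sqrt.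
have := lim_seriesZ (a ^+ 2) (ell2P x); rewrite -[_ *: limn _]/(_ * _) => <-.
congr (limn (series _)); apply/funext => k.
rewrite -[RHS]/(a ^+ 2 * `|x k| ^+ 2) -(real_normK (num_real a)) -exprMn.
by rewrite -norm_scale_Rcomplex.
Qed.

Fact ell2_normr0_eq0 x : ell2_norm x = 0 -> x = 0.
Proof.
by move=> x0; apply/val_inj/funext => k; exact: (ell2_norm_eq0 (ell2P x) x0).
Qed.

HB.instance Definition _ := Lmodule_isNormed.Build R (ell2 R)
  ell2_ler_normD ell2_normrZ ell2_normr0_eq0.

End Ell2.

Arguments ell2P {R} z _.

Section Flow.
Context {R : realType}.

Definition expi (x : R) : R[i] := (cos x +i* sin x)%C.

Variable lambda : nat -> R.

Fact flow_subproof (t : R) (z : ell2 R) :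
  (fun k => expi (lambda k * t) * z k : Rcomplex R) \in ell2_pred.
Proof.
apply/asboolP; apply: le_square_summable (ell2P z) => k.
rewrite [X in X ^+ 2]Normc.normcM [Normc.normc (expi _)]/= cos2Dsin2 sqrtr1.
by rewrite mul1r.
Qed.

(* The Hamiltonian system with
   H(q, p) = \sum_k lambda_k / 2 * (p_k ^ 2 + q_k ^ 2) is d/dt z_k = i lambda_k
   z_k in the coordinates z_k = q_k + i p_k (orientation with q' = - dH/dp,
   p' = dH/dq; see [trajectory_hamilton_equations]). As H need not be finite on
   all of [ell2 R] when [lambda] is unbounded, the system is given by its flow,
   defined for every initial condition. *)
Definition flow (t : R) (z : ell2 R) : ell2 R := Ell2 (flow_subproof t z).

Definition trajectory (z0 : ell2 R) : R -> ell2 R := fun t => flow t z0.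

Lemma trajectory_hamilton_equations (z0 : ell2 R) (k : nat) (t : R) :
  let q s := complex.Re (trajectory z0 s k) in
  let p s := complex.Im (trajectory z0 s k) in
  is_derive t 1 q (- (lambda k * p t)) /\ is_derive t 1 p (lambda k * q t).
Proof.
rewrite /=; case: (z0 k) => a b /=.
have dl : is_derive t (1 : R) ( *%R (lambda k)) (lambda k).
  by apply: is_derive_eq; rewrite -[_ *: _]/(_ * _) mulr1.
have dc : is_derive t 1 (fun s => cos (lambda k * s))
    (- (lambda k * sin (lambda k * t))).
  apply: is_derive_eq (is_derive1_comp (is_derive_cos _) dl) _.
  by rewrite mulNr mulrC.
have ds : is_derive t 1 (fun s => sin (lambda k * s))
    (lambda k * cos (lambda k * t)).
  by apply: is_derive_eq (is_derive1_comp (is_derive_sin _) dl) _; rewrite mulrC.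
split.
- apply: is_derive_eq; rewrite -![_ *: _]/(_ * _); ring.
- apply: is_derive_eq; rewrite -![_ *: _]/(_ * _); ring.
Qed.

Definition rationally_commensurable : Prop :=
  exists (m : nat) (j : 'I_m -> nat), injective j /\
  exists (i0 : 'I_m) (c : 'I_m -> rat),
    lambda (j i0) = \sum_(i < m | i != i0) ratr (c i) * lambda (j i).

Definition is_periodic (z : R -> ell2 R) : Prop :=
  exists2 tau : R, 0 < tau & periodic z tau.

Definition nondegenerate_torus (T : set (ell2 R)) : Prop :=
  exists r : nat -> R,
    [/\ forall k, 0 < r k, square_summable r &
        T = [set z : ell2 R | forall k, `|z k| = r k]].

(* [closure] is taken in the norm topology of [ell2 R]; for [A `<=` T] this is
   density of [A] in [T] for the topology induced on [T]. *)
Definition dense_in (A T : set (ell2 R)) : Prop := T `<=` closure A.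

End Flow.

(* Main.v *)
(* Write N x = |e^{ix} - 1|: it is even and subadditive.  A period tau forces
   N (lambda_k tau) = 0 for all k, which fails as soon as
   0 < lambda_k tau < pi.  An integer relation \sum_i n_i lambda_(j i) = 0 shows
   that if V_t z0 comes arbitrarily close to the point of the torus with
   coordinates e^{i mu_k} z0_k, then N (\sum_i n_i mu_(j i)) = 0; this excludes
   mu supported at one index j i0 with n_i0 mu_(j i0) = pi. *)
Require Import Defs.
From mathcomp Require Import all_boot all_order all_algebra.
From mathcomp Require Import complex.
From mathcomp Require Import all_classical all_reals all_analysis.

Import Order.TTheory GRing.Theory Num.Theory.
Import numFieldNormedType.Exports.

Local Open Scope classical_set_scope.
Local Open Scope ring_scope.

Section Expi.
Context {R : realType}.
Implicit Types x y : R.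

Lemma expi0 : expi (0 : R) = 1.
Proof. by rewrite /expi cos0 sin0. Qed.

Lemma expiD x y : expi (x + y) = expi x * expi y.
Proof.
by rewrite /expi cosD sinD; apply/eqP; rewrite eq_complex /= !eqxx /= addrC.
Qed.

Lemma normc_expi x : Normc.normc (expi x) = 1.
Proof. by rewrite /= cos2Dsin2 sqrtr1. Qed.

(** The function N of the overview: the distance from 1 to the point of the unit circle at angle
    [x]. *)
Definition chord x : R := Normc.normc (expi x - 1).

Lemma chord0 : chord 0 = 0.
Proof. by rewrite /chord expi0 subrr /= expr0n /= addr0 sqrtr0. Qed.

Lemma chord_ge0 x : 0 <= chord x.
Proof. exact: sqrtr_ge0. Qed.

Lemma chordN x : chord (- x) = chord x.
Proof. by rewrite /chord /expi cosN sinN /= !subr0 sqrrN. Qed.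

Lemma chordB x y : chord (x - y) = Normc.normc (expi x - expi y).
Proof.
rewrite -[LHS]mulr1 -(normc_expi y) /chord -Normc.normcM mulrBl mul1r.
by rewrite -expiD subrK.
Qed.

(** Pass from 1 to [expi (x + y)] through [expi x]: multiplication by [expi x] preserves distances,
    so the second leg has length [chord y]. *)
Lemma chordD x y : chord (x + y) <= chord x + chord y.
Proof.
have -> : chord (x + y) =
    Normc.normc ((expi x - 1) + (expi (x + y) - expi x)).
  by congr Normc.normc; rewrite [RHS]addrC subrKA.
apply: (le_trans (le_normcD _ _)).
rewrite lerD2l -[leLHS]/(Normc.normc (expi (x + y) - expi x)) -chordB.
by rewrite addrAC subrr add0r.
Qed.

Lemma chord_sum (I : Type) (s : seq I) (P : pred I) (f : I -> R) :
  chord (\sum_(i <- s | P i) f i) <= \sum_(i <- s | P i) chord (f i).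
Proof.
apply: (big_ind2 (fun a b => chord a <= b)) => [|a b c d ab cd|//].
  by rewrite chord0.
by apply: le_trans (chordD _ _) _; exact: lerD.
Qed.

Lemma chordMz (n : int) x : chord (n%:~R * x) <= `|n|%:R * chord x.
Proof.
suff chordMn (k : nat) : chord (k%:R * x) <= k%:R * chord x.
  case: n => n; first exact: chordMn.
  by rewrite NegzE abszN mulrNz mulNr chordN; exact: chordMn.
elim: k => [|k ih]; first by rewrite !mul0r chord0.
rewrite -natr1 !mulrDl !mul1r; apply: le_trans (chordD _ _) _.
by rewrite lerD2r.
Qed.

Lemma chord_eq0 x : chord x = 0 -> expi x = 1.
Proof. by move=> /Normc.eq0_normc /eqP; rewrite subr_eq0 => /eqP. Qed.

(** The sine vanishes at [pi], so the real parts -1 and 1 are compared instead. *)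
Lemma chord_pi_neq0 : chord (pi : R) != 0.
Proof.
apply/eqP => /chord_eq0 [/eqP]; rewrite cospi.
rewrite eq_sym -subr_eq0 opprK => /eqP h.
by have := ltr0n R 2; rewrite [2]h ltxx.
Qed.

Lemma chord_neq0 x : 0 < x < pi -> chord x != 0.
Proof.
move=> x0pi; apply/eqP => /chord_eq0 [_ sx].
by have := sin_gt0_pi x0pi; rewrite sx ltxx.
Qed.

End Expi.

Section Flow.
Context {R : realType}.
Implicit Types (lambda mu : nat -> R) (z : ell2 R).

Lemma norm_flow lambda (t : R) z k : `|flow lambda t z k| = `|z k|.
Proof. by rewrite [LHS]Normc.normcM normc_expi mul1r. Qed.

Lemma norm_coord_le z k : `|z k| <= `|z|.
Proof.
have h : `|z k| ^+ 2 <= `|z| ^+ 2.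
  rewrite [X in _ <= X](sqr_ell2_norm (ell2P z)).
  apply: le_trans (le_lim_series_sqr k.+1 (ell2P z)).
  by rewrite seriesSr lerDr seriesEnat/=; apply: sumr_ge0 => i _; exact: sqr_ge0.
by rewrite -(@ler_pXn2r _ 2)// nnegrE.
Qed.

(** Two frequency sequences are allowed because [flow mu 1] serves to rotate each coordinate by an
    arbitrary phase. *)
Lemma norm_flowB_coord lambda mu (s t : R) z k :
  `|(flow lambda s z - flow mu t z) k| =
  chord (lambda k * s - mu k * t) * `|z k|.
Proof.
rewrite chordB -[X in _ * X]/(Normc.normc (z k)) -Normc.normcM mulrBl.
by rewrite -[ell2_val _]/(val (_ - _)) raddfB.
Qed.

(** At every time [t] the relation cancels the phases [lambda (j i) * t], so the [mu (j i)] may be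
    replaced by the phase differences, whose chords are small when the two points are close. *)
Lemma closure_trajectory_relation lambda mu z (m : nat) (j : 'I_m -> nat)
    (n : 'I_m -> int) :
  (forall k, 0 < `|z k|) ->
  \sum_i (n i)%:~R * lambda (j i) = 0 ->
  closure (range (trajectory lambda z)) (flow mu 1 z) ->
  chord (\sum_i (n i)%:~R * mu (j i)) = 0.
Proof.
move=> z0 rel cl; apply/eqP; rewrite eq_le chord_ge0 andbT.
(* Points at distance d have phase differences of chord at most d / |z_(j i)|, so the whole sum has
   chord at most C d. As [C] may be 0, the radius below is [e / (C + 1)]. *)
pose C := \sum_i `|n i|%:R / `|z (j i)| : R.
have C0 : 0 <= C by apply: sumr_ge0 => i _; rewrite divr_ge0.
apply/ler_addgt0Pr => e e0; rewrite add0r.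
have d0 : 0 < e / (C + 1) by rewrite divr_gt0// ltr_wpDl.
have [_ [[t _ <-]]] := cl _ (nbhsx_ballx (flow mu 1 z) _ d0).
rewrite -ball_normE /= => dist.
have close i : chord (mu (j i) - lambda (j i) * t) <=
    (e / (C + 1)) / `|z (j i)|.
  rewrite ler_pdivlMr// -[mu (j i)]mulr1 -norm_flowB_coord.
  exact: le_trans (norm_coord_le _ _) (ltW dist).
have -> : \sum_i (n i)%:~R * mu (j i) =
    \sum_i (n i)%:~R * (mu (j i) - lambda (j i) * t).
  under [RHS]eq_bigr do rewrite mulrBr mulrA.
  by rewrite sumrB -mulr_suml rel mul0r subr0.
apply: le_trans (chord_sum _ _ _ _) _.
apply: (@le_trans _ _ (C * (e / (C + 1)))); last first.
  by rewrite mulrA ler_pdivrMr ?ltr_wpDl// mulrC ler_pM2l// lerDl.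
rewrite mulr_suml; apply: ler_sum => i _.
apply: le_trans (chordMz _ _) _.
by rewrite -[leRHS]mulrA ler_wpM2l// [leRHS]mulrC.
Qed.

Lemma rationally_commensurable_int lambda :
  rationally_commensurable lambda ->
  exists (m : nat) (j : 'I_m -> nat) (n : 'I_m -> int) (i0 : 'I_m),
    [/\ injective j, n i0 != 0 & \sum_i (n i)%:~R * lambda (j i) = 0].
Proof.
move=> [m [j [jinj [i0 [c rel]]]]].
(* Multiply the relation by the product of all denominators and move the [i0] term across: [n i] is
   the integer D c_i for i other than [i0], and [n i0] is -D, which is nonzero. *)
pose D : int := \prod_k denq (c k).
pose n i := if i == i0 then - D else numq (c i) * \prod_(k | k != i) denq (c k).
exists m, j, n, i0; split => //.
  by rewrite /n eqxx oppr_eq0; apply/prodf_neq0 => k _; exact: denq_neq0.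
rewrite (bigD1 i0)//= {1}/n eqxx rel mulr_sumr -big_split/=.
apply: big1 => i ii0; rewrite mulrA -mulrDl /n (negbTE ii0).
rewrite [X in X * _](_ : _ = 0) ?mul0r//.
rewrite /D (bigD1 i)//= /ratr mulrNz !rmorphM /= mulNr; apply/eqP.
rewrite addrC subr_eq0 mulrAC mulrCA divff ?mulr1//.
by rewrite intr_eq0 denq_neq0.
Qed.

Lemma trajectory_not_periodic lambda z :
  (forall k, 0 < lambda k) -> ~ bounded_fun (fun k => (lambda k)^-1) ->
  (forall k, 0 < `|z k|) -> ~ is_periodic (trajectory lambda z).
Proof.
move=> l0 unb z0 [tau tau0 per]; apply: unb.
(* The period itself bounds all [(lambda k)^-1]: otherwise some [lambda k * tau] lies strictly
   between 0 and 1, hence below [pi]. *)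
exists tau; split; first exact: num_real.
move=> M tauM k _ /=; rewrite gtr0_norm ?invr_gt0//.
apply: le_trans (ltW tauM); rewrite leNgt; apply/negP => lk.
suff /eqP : chord (lambda k * tau) = 0.
  apply/negP/chord_neq0; rewrite mulr_gt0//=.
  apply: (@lt_trans _ _ 1); first by rewrite -ltr_pdivlMl// mulr1.
  by apply: lt_le_trans (pi_ge2 R); rewrite ltr1n.
(* Coordinate [k] of the difference between the states at times [tau] and 0. *)
have /(congr1 (fun u : ell2 R => `|(u - flow lambda 0 z) k|)) := per 0.
rewrite add0r subrr normr0 norm_flowB_coord mulr0 subr0 => /eqP.
by rewrite mulf_eq0 (gt_eqF (z0 k)) orbF => /eqP.
Qed.

End Flow.

Theorem theorem1 (R : realType) (lambda : nat -> R)
  (lambda_gt0 : forall k, 0 < lambda k)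
  (lambda_comm : rationally_commensurable lambda)
  (lambdaV_unbounded : ~ bounded_fun (fun k => (lambda k)^-1)) :
  forall T : set (ell2 R), nondegenerate_torus T ->
  forall z0 : ell2 R, T z0 ->
    ~ is_periodic (trajectory lambda z0) /\
    ~ dense_in (range (trajectory lambda z0)) T.
Proof.
move=> T [r [r0 _ ->]] z0 Tz0.
have z0_gt0 k : 0 < `|z0 k| by rewrite Tz0.
split; first exact: trajectory_not_periodic.
have [m [j [n [i0 [jinj ni0 rel]]]]] :=
  rationally_commensurable_int lambda lambda_comm.
pose mu k : R := if k == j i0 then pi / (n i0)%:~R else 0.
(* Rotations keep the moduli, so this point is on the torus, and density would put it in the closure
   of the trajectory. *)
have Tmu k : `|flow mu 1 z0 k| = r k by rewrite norm_flow Tz0.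
move=> /(_ _ Tmu) /(closure_trajectory_relation _ _ _ _ _ _ z0_gt0 rel).
(* Since [j] is injective, [mu] vanishes at every other [j i], and the sum reduces to [pi]. *)
rewrite (bigD1 i0)//= big1 ?addr0 => [|i ii0]; last first.
  by rewrite /mu (inj_eq jinj) (negbTE ii0) mulr0.
rewrite /mu eqxx mulrC divfK ?intr_eq0//.
by apply/eqP/chord_pi_neq0.
Qed.
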